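(* (1) $\mathsf{TS4}$ has the finite model property. (2) $\mathsf{MS4}$ has the finite model property. (3) $\mathsf{MIPC}$ has the finite model property. Here a logic $L\in\{\mathsf{TS4},\mathsf{MS4},\mathsf{MIPC}\}$ has the finite model property if every formula $\varphi$ of its language with $L\nvdash\varphi$ is refuted on some finite algebra from the class of $\mathsf{TS4}$-algebras, $\mathsf{MS4}$-algebras, or monadic Heyting algebras, respectively.
   Context: For a unary modality $\blacksquare$, the $\mathsf{S4}$-axioms are $\blacksquare(p\to q)\to(\blacksquare p\to\blacksquare q)$, $\blacksquare p\to p$, $\blacksquare p\to\blacksquare\blacksquare p$; the $\mathsf{S5}$-axioms for $\forall$ are the $\mathsf{S4}$-axioms for $\forall$ together with $p\to\forall\exists p$, where $\exists:=\neg\forall\neg$. **TS4.** $\mathcal{ML}$ is the classical propositional language with unary modalities $\Box,\blacksquare_F,\blacksquare_P$; $\Diamond:=\neg\Box\neg$. $\mathsf{TS4}$ is the least set of $\mathcal{ML}$-formulas containing all classical tautologies; the $\mathsf{S4}$-axioms for each of $\Box,\blacksquare_F,\blacksquare_P$; $p\to\blacksquare_P\neg\blacksquare_F\neg p$ and $p\to\blacksquare_F\neg\blacksquare_P\neg p$; $\Diamond p\to\neg\blacksquare_F\neg p$ and $\neg\blacksquare_F\neg p\to\Diamond(\neg\blacksquare_F\neg p\wedge\neg\blacksquare_P\neg p)$; and closed under modus ponens, substitution, and necessitation for $\Box,\blacksquare_F,\blacksquare_P$. **MS4.** $\mathcal L_{\Box\forall}$ is the classical propositional language with unary modalities $\Box,\forall$.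 $\mathsf{MS4}$ is the least set of $\mathcal L_{\Box\forall}$-formulas containing all classical tautologies, the $\mathsf{S4}$-axioms for $\Box$, the $\mathsf{S5}$-axioms for $\forall$, the axiom $\Box\forall p\to\forall\Box p$, and closed under modus ponens, substitution, and necessitation for $\Box,\forall$. **MIPC.** $\mathcal L_{\forall\exists}$ is the propositional language with connectives $\bot,\wedge,\vee,\to$ (with $\neg\varphi:=\varphi\to\bot$) and two unary modalities $\forall,\exists$. $\mathsf{MIPC}$ is the least intuitionistic modal logic in $\mathcal L_{\forall\exists}$ containing all theorems of the intuitionistic propositional calculus; the axioms $\forall(p\wedge q)\leftrightarrow(\forall p\wedge\forall q)$, $\forall p\to p$, $\forall p\to\forall\forall p$; $\exists(p\vee q)\leftrightarrow(\exists p\vee\exists q)$, $p\to\exists p$, $\exists\exists p\to\exists p$, $(\exists p\wedge\exists q)\to\exists(\exists p\wedge q)$; $\exists\forall p\leftrightarrow\forall p$, $\exists p\leftrightarrow\forall\exists p$; and closed under modus ponens, substitution, necessitation ($\varphi/\forall\varphi$), and replacement of provable equivalents (from $\varphi\leftrightarrow\psi$ infer $\forall\varphi\leftrightarrow\forall\psi$ and $\exists\varphi\leftrightarrow\exists\psi$). **Algebras.** An interior operator on a Heyting (in particular boolean) algebra $H$ is $\mathsf i:H\to H$ with $\mathsf i(a\wedge b)=\mathsf ia\wedge\mathsf ib$, $\mathsf i1=1$, $\mathsf ia\le a$, $\mathsf ia\le\mathsf{ii}a$; a closure operator is $\mathsf c:H\to H$ with $\mathsf c(a\vee b)=\mathsf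 ca\vee\mathsf cb$, $\mathsf c0=0$, $a\le\mathsf ca$, $\mathsf{cc}a\le\mathsf ca$. - A $\mathsf{TS4}$-algebra is $(B,\Box,\blacksquare_F,\blacksquare_P)$ with $B$ a boolean algebra, $\Box,\blacksquare_F,\blacksquare_P$ interior operators on $B$, and for all $a\in B$: $a\le\blacksquare_P\neg\blacksquare_F\neg a$, $a\le\blacksquare_F\neg\blacksquare_P\neg a$, $\Diamond a\le\neg\blacksquare_F\neg a$, $\neg\blacksquare_F\neg a\le\Diamond(\neg\blacksquare_F\neg a\wedge\neg\blacksquare_P\neg a)$. - An $\mathsf{MS4}$-algebra is $(B,\Box,\forall)$ with $B$ a boolean algebra, $\Box,\forall$ interior operators on $B$, and for all $a\in B$: $a\le\forall\exists a$ and $\Box\forall a\le\forall\Box a$ (where $\exists=\neg\forall\neg$). - A monadic Heyting algebra is $(H,\forall,\exists)$ with $H$ a Heyting algebra, $\forall$ an interior operator and $\exists$ a closure operator on $H$ such that $\exists(\exists a\wedge b)=\exists a\wedge\exists b$, $\forall\exists a=\exists a$, $\exists\forall a=\forall a$ for all $a,b\in H$. A formula is refuted on an algebra if under some assignment of elements to propositional letters its value is different from $1$. *)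

(* Defs.v *)
From mathcomp Require Import all_boot all_order.

Set Implicit Arguments.
Unset Strict Implicit.
Unset Printing Implicit Defensive.

Import Order.Theory.
Local Open Scope order_scope.

(* Propositional formulas with unary modalities indexed by [M]; the
   propositional letters are indexed by [nat]. *)
Inductive form (M : Type) : Type :=
| Var of nat
| Bot
| And of form M & form M
| Or of form M & form M
| Imp of form M & form M
| Mod of M & form M.

Arguments Var {M} _.
Arguments Bot {M}.

Declare Scope modal_scope.
Delimit Scope modal_scope with ML.
Bind Scope modal_scope with form.
Notation "⊥" := Bot : modal_scope.
Notation "φ ∧ ψ" := (And φ ψ) (at level 40, left associativity) : modal_scope.
Notation "φ ∨ ψ" := (Or φ ψ) (at level 50, left associativity) : modal_scope.
Notation "φ ⇒ ψ" := (Imp φ ψ) (at level 55, right associativity) : modal_scope.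
Notation "¬ φ" := (Imp φ Bot) (at level 35, right associativity) : modal_scope.
Notation "φ ⇔ ψ" := (And (Imp φ ψ) (Imp ψ φ))
  (at level 57, no associativity) : modal_scope.
Notation "■[ m ] φ" := (Mod m φ)
  (at level 35, right associativity, format "■[ m ] φ") : modal_scope.
Notation "◆[ m ] φ" := (¬ ■[m] ¬ φ)%ML
  (at level 35, right associativity, format "◆[ m ] φ") : modal_scope.

Fixpoint subst M (s : nat -> form M) (f : form M) : form M :=
  match f with
  | Var n => s n
  | Bot => Bot
  | And f g => And (subst s f) (subst s g)
  | Or f g => Or (subst s f) (subst s g)
  | Imp f g => Imp (subst s f) (subst s g)
  | Mod m f => Mod m (subst s f)
  end.

(* Modal subformulas are treated as atoms: [v] is unconstrained on [Mod m f]. *)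
Record boolean_valuation M (v : form M -> bool) : Prop := {
  bval_bot : v Bot = false;
  bval_and : forall f g, v (And f g) = v f && v g;
  bval_or : forall f g, v (Or f g) = v f || v g;
  bval_imp : forall f g, v (Imp f g) = (v f ==> v g) }.

Definition tautology M (f : form M) : Prop :=
  forall v, boolean_valuation v -> v f = true.

Definition p {M} : form M := Var 0.
Definition q {M} : form M := Var 1.

Inductive S4_axiom M (m : M) : form M -> Prop :=
| S4_K : S4_axiom m (■[m](p ⇒ q) ⇒ (■[m]p ⇒ ■[m]q))%ML
| S4_T : S4_axiom m (■[m]p ⇒ p)%ML
| S4_4 : S4_axiom m (■[m]p ⇒ ■[m]■[m]p)%ML.

Inductive S5_axiom M (m : M) : form M -> Prop :=
| S5_S4 f : S4_axiom m f -> S5_axiom m f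
| S5_B : S5_axiom m (p ⇒ ■[m]◆[m]p)%ML.

(* The least normal classical modal logic containing [Ax]. *)
Inductive normal_logic M (Ax : form M -> Prop) : form M -> Prop :=
| nl_taut f : tautology f -> normal_logic Ax f
| nl_ax f : Ax f -> normal_logic Ax f
| nl_mp f g :
    normal_logic Ax (f ⇒ g)%ML -> normal_logic Ax f -> normal_logic Ax g
| nl_subst s f : normal_logic Ax f -> normal_logic Ax (subst s f)
| nl_nec m f : normal_logic Ax f -> normal_logic Ax (■[m]f)%ML.

Inductive TS4_mod : Type := tBox | tF | tP.

Inductive TS4_axiom : form TS4_mod -> Prop :=
| TS4_S4 m f : S4_axiom m f -> TS4_axiom f
| TS4_PF : TS4_axiom (p ⇒ ■[tP]◆[tF]p)%ML
| TS4_FP : TS4_axiom (p ⇒ ■[tF]◆[tP]p)%ML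
| TS4_BoxF : TS4_axiom (◆[tBox]p ⇒ ◆[tF]p)%ML
| TS4_FBox : TS4_axiom (◆[tF]p ⇒ ◆[tBox](◆[tF]p ∧ ◆[tP]p))%ML.

Definition TS4 : form TS4_mod -> Prop := normal_logic TS4_axiom.

Inductive MS4_mod : Type := mBox | mAll.

Inductive MS4_axiom : form MS4_mod -> Prop :=
| MS4_Box f : S4_axiom mBox f -> MS4_axiom f
| MS4_All f : S5_axiom mAll f -> MS4_axiom f
| MS4_comm : MS4_axiom (■[mBox]■[mAll]p ⇒ ■[mAll]■[mBox]p)%ML.

Definition MS4 : form MS4_mod -> Prop := normal_logic MS4_axiom.

(* Theorems of the intuitionistic propositional calculus, in a language with
   modalities: all substitution instances are included. *)
Inductive IPC M : form M -> Prop :=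
| IPC_K f g : IPC (f ⇒ g ⇒ f)%ML
| IPC_S f g h : IPC ((f ⇒ g ⇒ h) ⇒ (f ⇒ g) ⇒ f ⇒ h)%ML
| IPC_andl f g : IPC (f ∧ g ⇒ f)%ML
| IPC_andr f g : IPC (f ∧ g ⇒ g)%ML
| IPC_and f g : IPC (f ⇒ g ⇒ f ∧ g)%ML
| IPC_orl f g : IPC (f ⇒ f ∨ g)%ML
| IPC_orr f g : IPC (g ⇒ f ∨ g)%ML
| IPC_or f g h : IPC ((f ⇒ h) ⇒ (g ⇒ h) ⇒ f ∨ g ⇒ h)%ML
| IPC_bot f : IPC (⊥ ⇒ f)%ML
| IPC_mp f g : IPC (f ⇒ g)%ML -> IPC f -> IPC g.

(* [■[iEx]] is the primitive existential modality, not an abbreviation of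
   [◆[iAll]]. *)
Inductive MIPC_mod : Type := iAll | iEx.

Inductive MIPC_axiom : form MIPC_mod -> Prop :=
| MIPC_all_and : MIPC_axiom (■[iAll](p ∧ q) ⇔ (■[iAll]p ∧ ■[iAll]q))%ML
| MIPC_all_T : MIPC_axiom (■[iAll]p ⇒ p)%ML
| MIPC_all_4 : MIPC_axiom (■[iAll]p ⇒ ■[iAll]■[iAll]p)%ML
| MIPC_ex_or : MIPC_axiom (■[iEx](p ∨ q) ⇔ (■[iEx]p ∨ ■[iEx]q))%ML
| MIPC_ex_T : MIPC_axiom (p ⇒ ■[iEx]p)%ML
| MIPC_ex_4 : MIPC_axiom (■[iEx]■[iEx]p ⇒ ■[iEx]p)%ML
| MIPC_ex_and : MIPC_axiom ((■[iEx]p ∧ ■[iEx]q) ⇒ ■[iEx](■[iEx]p ∧ q))%ML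
| MIPC_ex_all : MIPC_axiom (■[iEx]■[iAll]p ⇔ ■[iAll]p)%ML
| MIPC_all_ex : MIPC_axiom (■[iEx]p ⇔ ■[iAll]■[iEx]p)%ML.

Inductive MIPC : form MIPC_mod -> Prop :=
| MIPC_ipc f : IPC f -> MIPC f
| MIPC_ax f : MIPC_axiom f -> MIPC f
| MIPC_mp f g : MIPC (f ⇒ g)%ML -> MIPC f -> MIPC g
| MIPC_subst s f : MIPC f -> MIPC (subst s f)
| MIPC_nec f : MIPC f -> MIPC (■[iAll]f)%ML
| MIPC_re m f g : MIPC (f ⇔ g)%ML -> MIPC (■[m]f ⇔ ■[m]g)%ML.

Record interior d (L : tbLatticeType d) (i : L -> L) : Prop := {
  interiorI : forall a b, i (a `&` b) = i a `&` i b;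
  interior1 : i \top = \top;
  interior_le : forall a, i a <= a;
  interior_idem : forall a, i a <= i (i a) }.

Record closure d (L : tbLatticeType d) (c : L -> L) : Prop := {
  closureU : forall a b, c (a `|` b) = c a `|` c b;
  closure0 : c \bot = \bot;
  closure_ge : forall a, a <= c a;
  closure_idem : forall a, c (c a) <= c a }.

Definition dual_op d (B : ctbDistrLatticeType d) (i : B -> B) (a : B) : B :=
  ~` i (~` a).

Record TS4_algebra d (B : ctbDistrLatticeType d) : Type := {
  TS4_box : B -> B;
  TS4_bF : B -> B;
  TS4_bP : B -> B;
  TS4_box_interior : interior TS4_box;
  TS4_bF_interior : interior TS4_bF;
  TS4_bP_interior : interior TS4_bP;
  TS4_le_PF : forall a, a <= TS4_bP (dual_op TS4_bF a);
  TS4_le_FP : forall a, a <= TS4_bF (dual_op TS4_bP a);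
  TS4_dia_le : forall a, dual_op TS4_box a <= dual_op TS4_bF a;
  TS4_le_dia : forall a,
    dual_op TS4_bF a <= dual_op TS4_box (dual_op TS4_bF a `&` dual_op TS4_bP a) }.

Record MS4_algebra d (B : ctbDistrLatticeType d) : Type := {
  MS4_box : B -> B;
  MS4_all : B -> B;
  MS4_box_interior : interior MS4_box;
  MS4_all_interior : interior MS4_all;
  MS4_le_all_ex : forall a, a <= MS4_all (dual_op MS4_all a);
  MS4_box_all : forall a, MS4_box (MS4_all a) <= MS4_all (MS4_box a) }.

(* A Heyting algebra is a bounded lattice whose meet has a residual; the
   distributive law is then a consequence. *)
Record monadic_heyting d (H : tbLatticeType d) : Type := {
  mh_imp : H -> H -> H;
  mh_all : H -> H;
  mh_ex : H -> H;
  mh_residual : forall a b c, (c <= mh_imp a b) = (c `&` a <= b);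
  mh_all_interior : interior mh_all;
  mh_ex_closure : closure mh_ex;
  mh_ex_meet : forall a b, mh_ex (mh_ex a `&` b) = mh_ex a `&` mh_ex b;
  mh_all_ex : forall a, mh_all (mh_ex a) = mh_ex a;
  mh_ex_all : forall a, mh_ex (mh_all a) = mh_all a }.

Fixpoint eval M d (L : tbLatticeType d) (imp : L -> L -> L) (op : M -> L -> L)
    (v : nat -> L) (f : form M) : L :=
  match f with
  | Var n => v n
  | Bot => \bot
  | And f g => eval imp op v f `&` eval imp op v g
  | Or f g => eval imp op v f `|` eval imp op v g
  | Imp f g => imp (eval imp op v f) (eval imp op v g)
  | Mod m f => op m (eval imp op v f)
  end.

Definition bimp d (B : ctbDistrLatticeType d) (a b : B) : B := ~` a `|` b.

Definition TS4_op d (B : ctbDistrLatticeType d) (A : TS4_algebra B)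
    (m : TS4_mod) : B -> B :=
  match m with tBox => TS4_box A | tF => TS4_bF A | tP => TS4_bP A end.

Definition MS4_op d (B : ctbDistrLatticeType d) (A : MS4_algebra B)
    (m : MS4_mod) : B -> B :=
  match m with mBox => MS4_box A | mAll => MS4_all A end.

Definition mh_op d (H : tbLatticeType d) (A : monadic_heyting H)
    (m : MIPC_mod) : H -> H :=
  match m with iAll => mh_all A | iEx => mh_ex A end.

Definition TS4_refuted d (B : ctbDistrLatticeType d) (A : TS4_algebra B)
    (f : form TS4_mod) : Prop :=
  exists v : nat -> B, eval (@bimp d B) (TS4_op A) v f <> \top.

Definition MS4_refuted d (B : ctbDistrLatticeType d) (A : MS4_algebra B)
    (f : form MS4_mod) : Prop :=
  exists v : nat -> B, eval (@bimp d B) (MS4_op A) v f <> \top.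

Definition mh_refuted d (H : tbLatticeType d) (A : monadic_heyting H)
    (f : form MIPC_mod) : Prop :=
  exists v : nat -> H, eval (mh_imp A) (mh_op A) v f <> \top.

Definition TS4_fmp : Prop :=
  forall f : form TS4_mod, ~ TS4 f ->
  exists (d : Order.disp_t) (B : finCTBDistrLatticeType d) (A : TS4_algebra B),
    TS4_refuted A f.

Definition MS4_fmp : Prop :=
  forall f : form MS4_mod, ~ MS4 f ->
  exists (d : Order.disp_t) (B : finCTBDistrLatticeType d) (A : MS4_algebra B),
    MS4_refuted A f.

Definition MIPC_fmp : Prop :=
  forall f : form MIPC_mod, ~ MIPC f ->
  exists (d : Order.disp_t) (H : finTBLatticeType d) (A : monadic_heyting H),
    mh_refuted A f.

(* Main.v *)
From HB Require Import structures.
From mathcomp Require Import all_boot all_order.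
From mathcomp Require Import boolp.
From mathcomp Require classical_sets.
Require Import Defs.

Set Implicit Arguments.
Unset Strict Implicit.
Unset Printing Implicit Defensive.

Import Order.Theory Order.DefaultSetSubsetOrder.
Local Open Scope order_scope.

(** Each of the three logics is complete for one kind of frame: a preorder [R]
    and an equivalence [E] such that [x E y R z] implies [x R u E z] for some
    [u] ([ms4_frame]). Write [Q] for the composite of [R] followed by [E], which
    is then a preorder. The points of the canonical model of a logic are the
    prime theories that contain it; existence of points comes from Zorn's lemma
    ([prime_extension]).

    - For [MS4], [R] and [E] interpret [mBox] and [mAll].
    - For [TS4], [R] interprets [tBox], the modalities [tF] and [tP] are
      interpreted by [Q] and its converse, and [E] is the intersection of [Q]
      with its converse; the last axiom says exactly that [Q] factors through
      [R] and [E] ([tF_factor]).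
    - For [MIPC], [R] is inclusion, [E] relates the points with the same
      universal formulas, [iEx] is interpreted by [E] and [iAll] by [Q]
      ([all_incl_factor], [point_ex]).

    The finite model is obtained by filtration ([filtration_exists]). The idea
    is that monadic boolean algebras are locally finite: closing a finite field
    of sets under [E]-saturation keeps it finite. Concretely, if the finite type
    [T] records through [tau] which subformulas hold at a point, then [x] is sent
    to the pair of [tau x] and the set of all [tau y] with [x E y]. Two codes are
    [E]-related when their second components agree, and [R] is replaced by the
    reflexive transitive closure of its image. Since the projection lifts the
    new [E] back to the old one, the commutation of [E] and [R] survives one step
    of [R] at a time, hence on the whole closure.

    A modal subformula persists along the relation of its modality, and an
    intuitionistic implication along inclusion. This passes from the canonical
    model to the filtration, which gives the truth lemmas [classical_truth] and
    [intuitionistic_truth]. The refuting algebra is the powerset of the finite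
    frame for [TS4] and [MS4], and the lattice of its [R]-upsets for [MIPC]. *)

(** * Theories and prime theories *)

Section Theories.
Variable M : Type.
Implicit Types (T L D : form M -> Prop) (f g h : form M).

(** Sets of formulas that contain intuitionistic logic and are closed under
    modus ponens; classical theories are among them. *)
Record theory T : Prop := {
  theory_ipc : forall f, IPC f -> T f;
  theory_mp : forall f g, T (f ⇒ g)%ML -> T f -> T g }.

(** For a theory of a classical logic, prime means maximal consistent. *)
Record prime T : Prop := {
  prime_theory :> theory T;
  prime_bot : ~ T ⊥%ML;
  prime_or : forall f g, T (f ∨ g)%ML -> T f \/ T g }.

Section Closed.
Variables (T : form M -> Prop) (thT : theory T).

Lemma theory_weaken f g : T g -> T (f ⇒ g)%ML.
Proof. exact (theory_mp thT (theory_ipc thT (IPC_K g f))). Qed.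

Lemma theory_id f : T (f ⇒ f)%ML.
Proof.
have ax g : IPC g -> T g := theory_ipc thT (f := g).
apply: (theory_mp thT (theory_mp thT _ _)).
- exact: ax (IPC_S f (f ⇒ f)%ML f).
- exact: ax (IPC_K f (f ⇒ f)%ML).
- exact: ax (IPC_K f f).
Qed.

Lemma theory_and f g : T (f ∧ g)%ML <-> T f /\ T g.
Proof.
split=> [Tfg | [Tf Tg]].
  split; first exact (theory_mp thT (theory_ipc thT (IPC_andl f g)) Tfg).
  exact (theory_mp thT (theory_ipc thT (IPC_andr f g)) Tfg).
exact (theory_mp thT (theory_mp thT (theory_ipc thT (IPC_and f g)) Tf) Tg).
Qed.

Lemma theory_orl f g : T f -> T (f ∨ g)%ML.
Proof. exact (theory_mp thT (theory_ipc thT (IPC_orl f g))). Qed.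

Lemma theory_orr f g : T g -> T (f ∨ g)%ML.
Proof. exact (theory_mp thT (theory_ipc thT (IPC_orr f g))). Qed.

Lemma theory_or f g h : T (f ⇒ h)%ML -> T (g ⇒ h)%ML -> T (f ∨ g ⇒ h)%ML.
Proof.
move=> Tf Tg.
exact (theory_mp thT (theory_mp thT (theory_ipc thT (IPC_or f g h)) Tf) Tg).
Qed.

Lemma theory_bot f : T ⊥%ML -> T f.
Proof. exact (theory_mp thT (theory_ipc thT (IPC_bot f))). Qed.

(** The deduction theorem: this theory is the extension of [T] by [f]. *)
Lemma theory_ext f : theory (fun g => T (f ⇒ g)%ML).
Proof.
split=> [g ipcg | g h Tgh Tg]; first exact: theory_weaken (theory_ipc thT ipcg).
exact (theory_mp thT (theory_mp thT (theory_ipc thT (IPC_S f g h)) Tgh) Tg).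
Qed.

End Closed.

Lemma theory_trans T f g h : theory T ->
  T (f ⇒ g)%ML -> T (g ⇒ h)%ML -> T (f ⇒ h)%ML.
Proof.
move=> thT Tfg Tgh.
exact (theory_mp (theory_ext thT f) (theory_weaken thT f Tgh) Tfg).
Qed.

(** The prime filter theorem: a theory disjoint from a set closed under
    disjunction extends to a prime theory that is still disjoint from it. *)
Lemma prime_extension T D : theory T ->
  (exists d, D d) -> (forall d e, D d -> D e -> D (d ∨ e)%ML) ->
  (forall d, D d -> ~ T d) ->
  exists U, [/\ prime U, forall f, T f -> U f & forall d, D d -> ~ U d].
Proof.
move=> thT [d0 Dd0] DU DT.
pose good U := [/\ theory U, forall f, T f -> U f & forall d, D d -> ~ U d].
(* the union of the empty chain is empty, so [P] must hold of the empty set *)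
pose P U := U = (fun=> False) \/ good U.
have [|U [PU maxU]] := @classical_sets.Zorn_bigcup _ P.
  move=> F FP totF.
  have [[U0 [FU0 gU0]] | none] := pselect (exists U, F U /\ good U); last first.
    left; apply/funext => f; apply/propext; split=> // -[U FU Uf].
    have [U0 | gU] := FP U FU; first by rewrite U0 in Uf.
    by case: none; exists U.
  have sup U V : F U -> F V -> exists2 W, F W /\ good W &
      (forall f, U f -> W f) /\ (forall f, V f -> W f).
    move=> FU FV.
    have pick2 W : F W -> exists2 W', F W' /\ good W' & forall f, W f -> W' f.
      move=> FW; case: (FP W FW) => [-> | gW]; last by exists W.
      by exists U0.
    have [U' [FU' gU'] UU'] := pick2 U FU; have [V' [FV' gV'] VV'] := pick2 V FV.
    case: (totF _ _ FU' FV') => sub.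
      by exists V' => //; split=> // f /UU' /sub.
    by exists U' => //; split=> // f /VV' /sub.
  right; split.
  - split=> [f ipcf | f g [U FU Ufg] [V FV Vf]].
      by exists U0 => //; case: gU0 => thU _ _; apply: theory_ipc.
    have [W [FW [thW _ _]] [UW VW]] := sup U V FU FV.
    by exists W => //; exact: (theory_mp thW (UW _ Ufg) (VW _ Vf)).
  - by move=> f Tf; exists U0 => //; case: gU0 => _ TU _; apply: TU.
  - move=> d Dd [U FU Ud]; case: (FP U FU) => [U0' | [_ _ DU']].
      by rewrite U0' in Ud.
    exact: DU' Dd Ud.
have maxU' V : good V -> (forall f, U f -> V f) -> forall f, V f -> U f.
  move=> gV UV f Vf; apply: contrapT => nUf; apply: (maxU V); last by right.
  by split=> [//|VU]; apply/nUf/VU.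
have gT : good T by [].
have gU : good U.
  case: PU => // U0; have bad := maxU' T gT; rewrite U0 in bad.
  by case: (bad (fun g => @False_ind (T g)) (⊥ ⇒ ⊥)%ML); apply: theory_id.
case: (gU) => thU TU DU'; exists U; split=> //; split=> //.
  by move=> Ubot; apply: DU' Dd0 _; apply: theory_bot.
move=> f g Ufg; have [Uf | nUf] := pselect (U f); first by left.
right; have [// | nUg] := pselect (U g).
(* by maximality, a formula outside [U] implies a formula of [D] in [U] *)
have meets h : ~ U h -> exists2 d, D d & U (h ⇒ d)%ML.
  move=> nUh; apply: contrapT => none; apply: nUh.
  apply: (maxU' (fun g => U (h ⇒ g)%ML)); last exact: theory_id.
    split; first exact: theory_ext.
      by move=> g' /TU; apply: theory_weaken.
    by move=> d Dd Uhd; apply: none; exists d.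
  by move=> g'; apply: theory_weaken.
have [d Dd Ufd] := meets f nUf; have [e De Uge] := meets g nUg.
case: (DU' _ (DU d e Dd De)); apply: (theory_mp thU _ Ufg).
apply: theory_or => //; [apply: (theory_trans thU Ufd) | apply: (theory_trans thU Uge)].
  by apply: theory_ipc => //; apply: IPC_orl.
by apply: theory_ipc => //; apply: IPC_orr.
Qed.

(** The points of the canonical model of a logic [L]: its prime theories. *)
Record point L := Point {
  pt :> form M -> Prop;
  pt_prime : prime pt;
  pt_logic : forall f, L f -> pt f }.

Section Points.
Variable L : form M -> Prop.
Implicit Types (x y : point L).

Lemma point_extension T D : theory T -> (forall f, L f -> T f) ->
  (exists d, D d) -> (forall d e, D d -> D e -> D (d ∨ e)%ML) ->
  (forall d, D d -> ~ T d) ->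
  exists2 x : point L, (forall f, T f -> x f) & forall d, D d -> ~ x d.
Proof.
move=> thT LT D0 DU DT; have [U [pU TU DU']] := prime_extension thT D0 DU DT.
by exists (Point pU (fun f Lf => TU f (LT f Lf))).
Qed.

Lemma point_separation T g : theory T -> (forall f, L f -> T f) -> ~ T g ->
  exists2 x : point L, (forall f, T f -> x f) & ~ x g.
Proof.
move=> thT LT nTg.
have [||d Dd Td|x Tx Dx] :=
    @point_extension T (fun d => T (d ⇒ g)%ML) thT LT.
- by exists g; apply: theory_id.
- by move=> d e; apply: theory_or.
- exact/nTg/(theory_mp thT Dd Td).
- by exists x => //; apply: Dx; apply: theory_id.
Qed.

Lemma point_complete f : theory L -> (forall x, x f) -> L f.
Proof.
move=> thL valid; apply: contrapT => nLf.
have [x _ nxf] := point_separation thL (fun g Lg => Lg) nLf.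
by case: (nxf (valid x)).
Qed.

Lemma point_bot x : ~ x ⊥%ML.
Proof. by case: (pt_prime x). Qed.

Lemma point_and x f g : x (f ∧ g)%ML <-> x f /\ x g.
Proof. exact: theory_and (prime_theory (pt_prime x)) f g. Qed.

Lemma point_or x f g : x (f ∨ g)%ML <-> x f \/ x g.
Proof.
split; first by case: (pt_prime x) => _ _; apply.
by case; [apply: theory_orl | apply: theory_orr]; apply: pt_prime.
Qed.

Lemma point_mp x f g : x (f ⇒ g)%ML -> x f -> x g.
Proof. by move=> xfg xf; exact (theory_mp (pt_prime x) xfg xf). Qed.

(** Implication is interpreted by inclusion of points. *)
Lemma point_imp x f g :
  x (f ⇒ g)%ML <-> forall y, (forall h, x h -> y h) -> y f -> y g.
Proof.
split=> [xfg y xy yf | sub]; first exact: (point_mp (xy _ xfg) yf).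
apply: contrapT => nxfg; have thx := prime_theory (pt_prime x).
have [|y xy nyg] := point_separation (theory_ext thx f) _ nxfg.
  by move=> g' /(pt_logic x); apply: theory_weaken.
apply/nyg/sub; last by apply: xy; apply: theory_id.
by move=> h xh; apply: xy; apply: theory_weaken.
Qed.

End Points.

End Theories.

(** * Canonical frames of the classical logics *)

(** Frames for [MS4]: a preorder [R] and an equivalence [E], where a path along
    [E] and then [R] can be traded for one along [R] and then [E]. *)
Record ms4_frame (X : Type) (R E : X -> X -> Prop) : Prop := {
  frame_refl : forall x, R x x;
  frame_trans : forall x y z, R x y -> R y z -> R x z;
  frame_erefl : forall x, E x x;
  frame_esym : forall x y, E x y -> E y x;
  frame_etrans : forall x y z, E x y -> E y z -> E x z;
  frame_comm : forall x y z, E x y -> R y z -> exists2 u, R x u & E u z }.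

(** The substitution that instantiates the axioms, stated with the letters [p]
    and [q], at [f] and [g]. *)
Definition pick_subst M (f g : form M) (n : nat) : form M :=
  if n is 0 then f else g.

Section NormalLogic.
Variables (M : Type) (Ax : form M -> Prop).
Let L := normal_logic Ax.
Implicit Types (x y z : point L) (m : M) (f g h : form M).

Lemma IPC_tautology f : IPC f -> tautology f.
Proof.
move=> ipcf v [vbot vand vor vimp].
elim: ipcf => {f} [f g|f g h|f g|f g|f g|f g|f g|f g h|f|f g _ + _ vf];
  rewrite ?(vimp, vand, vor, vbot) ?vf //;
  by case: (v f) => //; case: (v g) => //; case: (v h).
Qed.

Lemma normal_theory : theory L.
Proof.
split=> [f /IPC_tautology | f g]; first exact: nl_taut.
exact: nl_mp.
Qed.

Lemma point_neg x f : x (¬ f)%ML <-> ~ x f.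
Proof.
split=> [xnf xf | nxf]; first exact: (point_bot (point_mp xnf xf)).
suff /point_or[] : x (f ∨ ¬ f)%ML by [].
apply/pt_logic/nl_taut => v [vbot vand vor vimp].
by rewrite vor vimp vbot; case: (v f).
Qed.

(** The canonical accessibility relation of the modality [m]. *)
Definition mod_rel m x y : Prop := forall g, x (■[m]g)%ML -> y g.

Section S4.
Variables (m : M) (S4m : forall f, S4_axiom m f -> Ax f).

Lemma point_K x f g : x (■[m](f ⇒ g))%ML -> x (■[m]f)%ML -> x (■[m]g)%ML.
Proof.
move=> xfg; apply: point_mp; apply: point_mp xfg; apply: pt_logic.
exact (nl_subst (pick_subst f g) (nl_ax (S4m (S4_K m)))).
Qed.

Lemma box_theory x : theory (fun g => x (■[m]g)%ML).
Proof.
split=> [f ipcf | f g]; last exact: point_K.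
exact/pt_logic/nl_nec/(theory_ipc normal_theory).
Qed.

Lemma point_box x f : x (■[m]f)%ML <-> forall y, mod_rel m x y -> y f.
Proof.
split=> [xf y | all_f]; first exact.
apply: contrapT => nxf.
have [|y xy nyf] := point_separation (L := L) (box_theory x) _ nxf.
  by move=> g Lg; apply/pt_logic/nl_nec.
exact/nyf/all_f.
Qed.

Lemma point_dia x f :
  x (◆[m]f)%ML <-> exists2 y, mod_rel m x y & y f.
Proof.
split=> [/point_neg ndia | [y xy yf]].
  apply: contrapT => none; apply/ndia/point_box => y xy; apply/point_neg => yf.
  by apply: none; exists y.
by apply/point_neg => /point_box/(_ y xy)/point_neg; apply.
Qed.

Lemma mod_refl x : mod_rel m x x.
Proof.
move=> f; apply: point_mp; apply: pt_logic.
exact (nl_subst (pick_subst f f) (nl_ax (S4m (S4_T m)))).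
Qed.

Lemma point_4 x f : x (■[m]f)%ML -> x (■[m]■[m]f)%ML.
Proof.
apply: point_mp; apply: pt_logic.
exact (nl_subst (pick_subst f f) (nl_ax (S4m (S4_4 m)))).
Qed.

Lemma mod_trans x y z : mod_rel m x y -> mod_rel m y z -> mod_rel m x z.
Proof. by move=> xy yz g /point_4/xy/yz. Qed.

End S4.

(** Compactness for successors: if [P] is nonempty and directed downwards, and
    each member of [P] holds at some [m]-successor of [x], then all of them hold
    at a common one. *)
Lemma mod_witness m x (P : form M -> Prop) :
  (forall f, S4_axiom m f -> Ax f) ->
  (exists f, P f) ->
  (forall f g, P f -> P g -> exists2 h, P h &
     forall y, y h -> y f /\ y g) ->
  (forall f, P f -> exists2 y, mod_rel m x y & y f) ->
  exists2 y, mod_rel m x y & forall f, P f -> y f.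
Proof.
move=> S4m [f0 Pf0] dirP satP.
pose T g := exists2 f, P f & forall y, mod_rel m x y -> y f -> y g.
have thT : theory T.
  split=> [g ipcg | g h [f1 Pf1 T1] [f2 Pf2 T2]].
    by exists f0 => // y _ _; apply: theory_ipc ipcg; apply: pt_prime.
  have [f Pf fE] := dirP _ _ Pf1 Pf2.
  by exists f => // y xy /fE[/(T1 y xy) + /(T2 y xy)]; apply: point_mp.
have [g Lg||y Ty _] := point_separation (L := L) (T := T) (g := ⊥%ML) thT.
- by exists f0 => // y _ _; apply: pt_logic.
- by move=> [f Pf Tbot]; have [y xy yf] := satP f Pf; case: (point_bot (Tbot y xy yf)).
exists y => [g /point_box xg | f Pf]; apply: Ty.
  by exists f0 => // y' xy' _; apply: xg.
by exists f.
Qed.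

End NormalLogic.

Section MS4Canonical.
Local Notation pointM := (point MS4).
Implicit Types (x y z : pointM).

Let S4box f (ax : S4_axiom mBox f) : MS4_axiom f := MS4_Box ax.
Let S4all f (ax : S4_axiom mAll f) : MS4_axiom f := MS4_All (S5_S4 ax).

Lemma mall_sym x y : mod_rel mAll x y -> mod_rel mAll y x.
Proof.
move=> xy g ynecg; apply: contrapT => nxg.
have xB : x (■[mAll]◆[mAll]¬g)%ML.
  apply: (point_mp (f := (¬g)%ML)); last exact/point_neg.
  apply: pt_logic.
  exact (nl_subst (pick_subst (¬g)%ML g) (nl_ax (MS4_All (S5_B _)))).
have [z yz /point_neg] := (point_dia S4all _ _).1 (xy _ xB).
by case; apply: yz.
Qed.

Lemma MS4_canonical_frame :
  ms4_frame (@mod_rel _ MS4_axiom mBox) (@mod_rel _ MS4_axiom mAll).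
Proof.
split.
- exact: mod_refl S4box.
- exact: mod_trans S4box.
- exact: mod_refl S4all.
- exact: mall_sym.
- exact: mod_trans S4all.
move=> x y z xy yz.
have [||f [h zh ->]|u xu zu] := @mod_witness _ _ mBox x
    (fun f => exists2 h, z (■[mAll]h)%ML & f = ■[mAll]h)%ML S4box.
- exists (■[mAll](⊥ ⇒ ⊥))%ML; exists (⊥ ⇒ ⊥)%ML => //.
  apply/(point_box S4all) => w _; exact: theory_id (pt_prime w) _.
- move=> _ _ [f zf ->] [g zg ->]; exists (■[mAll](f ∧ g))%ML.
    exists (f ∧ g)%ML => //; apply/(point_box S4all) => w zw.
    by apply/point_and; split; apply: zw.
  by move=> w wfg; split; apply/(point_box S4all) => w' /(_ _ wfg)/point_and[].
(* otherwise [x] satisfies [■[mBox]¬■[mAll]h], hence also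
   [■[mBox]■[mAll]¬■[mAll]h], to which the commutation axiom applies *)
- apply: contrapT => none.
  have xn : x (■[mBox]■[mAll]¬■[mAll]h)%ML.
    apply/(point_box S4box) => w xw; apply/(point_box S4all) => w' ww'.
    apply/point_neg => w'h; apply: none; exists w => //.
    apply/(point_box S4all) => v wv.
    exact: (mod_trans S4all (mall_sym ww') wv w'h).
  have xn' : x (■[mAll]■[mBox]¬■[mAll]h)%ML.
    apply: point_mp xn; apply: pt_logic.
    exact (nl_subst (pick_subst (¬■[mAll]h)%ML h) (nl_ax MS4_comm)).
  by have /point_neg := yz _ (xy _ xn'); apply.
exists u => //; apply: mall_sym => g zg; apply: (mod_refl S4all).
by apply: zu; exists g.
Qed.

End MS4Canonical.

Section TS4Canonical.
Local Notation pointT := (point TS4).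
Implicit Types (x y z : pointT).

Let S4 m f (ax : S4_axiom m f) : TS4_axiom f := TS4_S4 ax.
Local Notation rel m := (@mod_rel _ TS4_axiom m).

(** The tense axioms make the relation of [tP] the converse of that of [tF]. *)
Lemma tP_rel x y : rel tP x y <-> rel tF y x.
Proof.
split=> xy g yg; apply: contrapT => ng.
  have xB : x (■[tP]◆[tF]¬g)%ML.
    apply: (point_mp (f := (¬g)%ML)); last exact/point_neg.
    by apply: pt_logic; exact (nl_subst (pick_subst (¬g)%ML g) (nl_ax TS4_PF)).
  have [z yz /point_neg] := (point_dia (@S4 tF) _ _).1 (xy _ xB).
  by case; apply: yz.
have yB : y (■[tF]◆[tP]¬g)%ML.
  apply: (point_mp (f := (¬g)%ML)); last exact/point_neg.
  by apply: pt_logic; exact (nl_subst (pick_subst (¬g)%ML g) (nl_ax TS4_FP)).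
have [z yz /point_neg] := (point_dia (@S4 tP) _ _).1 (xy _ yB).
by case; apply: yz.
Qed.

Lemma tBox_tF x y : rel tBox x y -> rel tF x y.
Proof.
move=> xy g xg; apply: contrapT => nyg.
have xd : x (◆[tBox]¬g)%ML.
  by apply/(point_dia (@S4 tBox)); exists y => //; apply/point_neg.
have : x (◆[tF]¬g)%ML.
  apply: point_mp xd; apply: pt_logic.
  exact (nl_subst (pick_subst (¬g)%ML g) (nl_ax TS4_BoxF)).
by case/(point_dia (@S4 tF)) => z xz /point_neg; case; apply: xz.
Qed.

(** The point [z] is found by requiring [◆[tF]h ∧ ◆[tP]h] of it for every [h]
    in [y]. *)
Lemma tF_factor x y : rel tF x y ->
  exists2 z, rel tBox x z & rel tF z y /\ rel tF y z.
Proof.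
move=> xy.
have [||f [h yh ->]|z xz zP] := @mod_witness _ _ tBox x
    (fun f => exists2 h, y h & f = ◆[tF]h ∧ ◆[tP]h)%ML (@S4 tBox).
- exists (◆[tF](⊥ ⇒ ⊥) ∧ ◆[tP](⊥ ⇒ ⊥))%ML; exists (⊥ ⇒ ⊥)%ML => //.
  exact: theory_id (pt_prime y) _.
- move=> _ _ [f yf ->] [g yg ->]; exists (◆[tF](f ∧ g) ∧ ◆[tP](f ∧ g))%ML.
    by exists (f ∧ g)%ML => //; apply/point_and.
  move=> w /point_and[/(point_dia (@S4 tF))[u wu /point_and[uf ug]]].
  move=> /(point_dia (@S4 tP))[v wv /point_and[vf vg]].
  have dF h : u h -> w (◆[tF]h)%ML by move=> uh; apply/(point_dia (@S4 tF)); exists u.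
  have dP h : v h -> w (◆[tP]h)%ML by move=> vh; apply/(point_dia (@S4 tP)); exists v.
  by split; apply/point_and; split; [apply: dF | apply: dP | apply: dF | apply: dP].
- apply/(point_dia (@S4 tBox)).
  apply: (point_mp (f := (◆[tF]h)%ML)); last by apply/(point_dia (@S4 tF)); exists y.
  by apply: pt_logic; exact (nl_subst (pick_subst h h) (nl_ax TS4_FBox)).
exists z => //; split.
  move=> g zg; apply: contrapT => nyg.
  have /point_and[/(point_dia (@S4 tF))[w zw /point_neg]] : z (◆[tF]¬g ∧ ◆[tP]¬g)%ML.
    by apply: zP; exists (¬g)%ML => //; apply/point_neg.
  by case; apply: zw.
apply/tP_rel => g zg; apply: contrapT => nyg.
have /point_and[_ /(point_dia (@S4 tP))[w zw /point_neg]] : z (◆[tF]¬g ∧ ◆[tP]¬g)%ML.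
  by apply: zP; exists (¬g)%ML => //; apply/point_neg.
by case; apply: zw.
Qed.

Lemma TS4_canonical_frame :
  ms4_frame (rel tBox) (fun x y => rel tF x y /\ rel tF y x).
Proof.
have trF := @mod_trans _ _ tF (@S4 tF).
split.
- exact: mod_refl (@S4 tBox).
- exact: mod_trans (@S4 tBox).
- by move=> x; split; exact: (mod_refl (@S4 tF)).
- by move=> x y [].
- by move=> x y z [xy yx] [yz zy]; split; [exact: (trF _ _ _ xy yz) | exact: (trF _ _ _ zy yx)].
move=> x y z [xy yx] yz.
have [u xu uz] := tF_factor (trF _ _ _ xy (tBox_tF yz)).
by exists u.
Qed.

End TS4Canonical.

(** * Canonical frame of the intuitionistic logic *)

Section MIPCCanonical.
Local Notation pointI := (point MIPC).
Implicit Types (x y z : pointI) (f g h : form MIPC_mod).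

(** The canonical relations of [MIPC]: [pt_incl] interprets implication,
    [all_incl] the modality [iAll], and [all_eq] the modality [iEx]. *)
Definition pt_incl x y : Prop := forall f, x f -> y f.
Definition all_incl x y : Prop := forall f, x (■[iAll]f)%ML -> y (■[iAll]f)%ML.
Definition all_eq x y : Prop := all_incl x y /\ all_incl y x.

Lemma MIPC_theory : theory MIPC.
Proof. by split=> [f | f g]; [apply: MIPC_ipc | apply: MIPC_mp]. Qed.

(** Instances of the axioms, read at a point. *)
Lemma MIPC_point (x : pointI) f g h : MIPC_axiom f ->
  x (subst (pick_subst g h) f).
Proof. by move=> ax; apply/pt_logic/MIPC_subst/MIPC_ax. Qed.

Lemma point_all_and x f g :
  x (■[iAll](f ∧ g))%ML <-> x (■[iAll]f)%ML /\ x (■[iAll]g)%ML.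
Proof.
have /point_and[/= to from] := MIPC_point x f g MIPC_all_and.
rewrite -point_and; split; [exact: point_mp to | exact: point_mp from].
Qed.

Lemma point_all_T x f : x (■[iAll]f)%ML -> x f.
Proof. exact: point_mp (MIPC_point x f f MIPC_all_T). Qed.

Lemma point_all_4 x f : x (■[iAll]f)%ML -> x (■[iAll]■[iAll]f)%ML.
Proof. exact: point_mp (MIPC_point x f f MIPC_all_4). Qed.

Lemma point_ex_or x f g :
  x (■[iEx](f ∨ g))%ML <-> x (■[iEx]f)%ML \/ x (■[iEx]g)%ML.
Proof.
have /point_and[/= to from] := MIPC_point x f g MIPC_ex_or.
rewrite -point_or; split; [exact: point_mp to | exact: point_mp from].
Qed.

Lemma point_ex_T x f : x f -> x (■[iEx]f)%ML.
Proof. exact: point_mp (MIPC_point x f f MIPC_ex_T). Qed.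

Lemma point_ex_and x f g :
  x (■[iEx]f)%ML -> x (■[iEx]g)%ML -> x (■[iEx](■[iEx]f ∧ g))%ML.
Proof.
by move=> xf xg; apply: (point_mp (MIPC_point x f g MIPC_ex_and)); apply/point_and.
Qed.

Lemma point_ex_all x f : x (■[iEx]■[iAll]f)%ML <-> x (■[iAll]f)%ML.
Proof.
have /point_and[/= to from] := MIPC_point x f f MIPC_ex_all.
by split; [exact: point_mp to | exact: point_mp from].
Qed.

Lemma point_all_ex x f : x (■[iEx]f)%ML <-> x (■[iAll]■[iEx]f)%ML.
Proof.
have /point_and[/= to from] := MIPC_point x f f MIPC_all_ex.
by split; [exact: point_mp to | exact: point_mp from].
Qed.

Lemma MIPC_iff f g : (forall x, x f <-> x g) -> MIPC (f ⇔ g)%ML.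
Proof.
move=> fg; apply: (point_complete MIPC_theory) => x.
by apply/point_and; split; apply/point_imp => y _ /fg.
Qed.

Lemma MIPC_re_point m f g x : (forall y, y f <-> y g) ->
  x (■[m]f)%ML -> x (■[m]g)%ML.
Proof.
move=> fg; apply: point_mp.
by have /point_and[] := pt_logic x (MIPC_re m (MIPC_iff fg)).
Qed.

Lemma point_all_mono x f g : (forall y, y f -> y g) ->
  x (■[iAll]f)%ML -> x (■[iAll]g)%ML.
Proof.
move=> fg xf; suff /point_all_and[] : x (■[iAll](f ∧ g))%ML by [].
apply: MIPC_re_point xf => y; rewrite point_and.
by split=> [yf | []] //; split=> //; apply: fg.
Qed.

Lemma point_ex_mono x f g : (forall y, y f -> y g) ->
  x (■[iEx]f)%ML -> x (■[iEx]g)%ML.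
Proof.
move=> fg xf; suff : x (■[iEx](f ∨ g))%ML.
  by apply: MIPC_re_point => y; rewrite point_or; split=> [[/fg|]|]; auto.
by apply/point_ex_or; left.
Qed.

Lemma all_theory x : theory (fun g => x (■[iAll]g)%ML).
Proof.
split=> [f ipcf | f g xfg xf]; first exact/pt_logic/MIPC_nec/MIPC_ipc.
have : x (■[iAll]((f ⇒ g) ∧ f))%ML by apply/point_all_and.
by apply: point_all_mono => y /point_and[]; apply: point_mp.
Qed.

(** The fixed points of [iAll] are closed under implication, because they are
    also the fixed points of [iEx]. *)
Lemma point_imp_fixed x f g :
  x (■[iAll]f ⇒ ■[iAll]g)%ML -> x (■[iAll](■[iAll]f ⇒ ■[iAll]g))%ML.
Proof.
set c := (_ ⇒ _)%ML => /point_ex_T/point_all_ex; apply: point_all_mono => y yc.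
apply/point_imp => u yu uf; apply/point_ex_all.
have : u (■[iEx](■[iEx]■[iAll]f ∧ c))%ML.
  by apply: point_ex_and; [apply/point_ex_all | apply: yu].
by apply: point_ex_mono => v /point_and[/point_ex_all vf vc]; apply: point_mp vc vf.
Qed.

(** The factorization of [all_incl]: extend the theory generated by [x] and the
    universal formulas of [y] to a prime one that avoids every formula below a
    universal formula outside [y]. *)
Lemma all_incl_factor x y : all_incl x y ->
  exists2 z, pt_incl x z & all_eq z y.
Proof.
move=> xy.
pose T g := exists2 h, y (■[iAll]h)%ML & x (■[iAll]h ⇒ g)%ML.
pose D d := exists2 h, ~ y (■[iAll]h)%ML & forall w : pointI, w d -> w (■[iAll]h)%ML.
have ytop : y (■[iAll](⊥ ⇒ ⊥))%ML.
  exact/pt_logic/MIPC_nec/(theory_id MIPC_theory).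
have thx := prime_theory (pt_prime x).
have xT g : x g -> T g by exists (⊥ ⇒ ⊥)%ML => //; apply: theory_weaken.
have thT : theory T.
  split=> [g ipcg | g h [f1 y1 x1] [f2 y2 x2]].
    exact/xT/(theory_ipc thx).
  exists (f1 ∧ f2)%ML; first exact/point_all_and.
  apply/point_imp => w xw /point_all_and[w1 w2].
  exact: (point_mp (point_mp (xw _ x1) w1) (point_mp (xw _ x2) w2)).
have [||d e|d [h' nyh' dh'] [h yh xh]|z Tz Dz] :=
    point_extension (L := MIPC) (D := D) thT.
- by move=> f Lf; apply/xT/pt_logic.
- exists ⊥%ML; exists ⊥%ML; last by move=> w /point_bot.
  by move=> /point_all_T/point_bot.
- move=> [h nyh dh] [h' nyh' eh']; exists (■[iAll]h ∨ ■[iAll]h')%ML.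
    by move=> /point_all_T/point_or[].
  by move=> w /point_or[/dh|/eh'] /point_all_4; apply: point_all_mono => v vh;
    apply/point_or; [left | right].
- have xc : x (■[iAll]h ⇒ ■[iAll]h')%ML.
    by apply/point_imp => w xw wh; apply: dh'; apply: point_mp (xw _ xh) wh.
  by apply/nyh'/(point_mp (point_all_T (xy _ (point_imp_fixed xc)))).
exists z; first by move=> f /xT/Tz.
split=> f; last first.
  by move=> yf; apply: Tz; exists f => //; apply: theory_id.
by move=> zf; apply: contrapT => nyf; apply: Dz zf; exists f.
Qed.

Lemma point_all x f : x (■[iAll]f)%ML <-> forall y, all_incl x y -> y f.
Proof.
split=> [xf y /(_ _ xf)/point_all_T // | all_f].
apply: contrapT => nxf.
have [|y xy nyf] := point_separation (L := MIPC) (all_theory x) _ nxf.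
  by move=> g Lg; apply/pt_logic/MIPC_nec.
by apply/nyf/all_f => g /point_all_4/xy.
Qed.

(** A witness for [■[iEx]f] at [x]: extend the theory generated by [f] and the
    universal formulas of [x] to a prime one that avoids every formula below a
    universal formula outside [x]. *)
Lemma point_ex x f : x (■[iEx]f)%ML <-> exists2 y, all_eq x y & y f.
Proof.
split=> [xf | [y [xy yx] /point_ex_T/point_all_ex/yx/point_all_ex //]].
pose T g := exists2 h, x (■[iAll]h)%ML &
  forall w : pointI, w (■[iAll]h)%ML -> w f -> w g.
pose D d := exists2 h, ~ x (■[iAll]h)%ML & forall w : pointI, w d -> w (■[iAll]h)%ML.
have xtop : x (■[iAll](⊥ ⇒ ⊥))%ML.
  exact/pt_logic/MIPC_nec/(theory_id MIPC_theory).
have thT : theory T.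
  split=> [g ipcg | g h [f1 x1 T1] [f2 x2 T2]].
    by exists (⊥ ⇒ ⊥)%ML => // w _ _; apply/pt_logic/MIPC_ipc.
  exists (f1 ∧ f2)%ML; first exact/point_all_and.
  by move=> w /point_all_and[w1 w2] wf; exact: (point_mp (T1 w w1 wf) (T2 w w2 wf)).
have [||d e|d [h' nxh' dh'] [h xh hd]|z Tz Dz] :=
    point_extension (L := MIPC) (D := D) thT.
- by move=> g Lg; exists (⊥ ⇒ ⊥)%ML => // w _ _; apply: pt_logic.
- exists ⊥%ML; exists ⊥%ML; last by move=> w /point_bot.
  by move=> /point_all_T/point_bot.
- move=> [h nyh dh] [h' nyh' eh']; exists (■[iAll]h ∨ ■[iAll]h')%ML.
    by move=> /point_all_T/point_or[].
  by move=> w /point_or[/dh|/eh'] /point_all_4; apply: point_all_mono => v vh;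
    apply/point_or; [left | right].
- apply/nxh'/point_ex_all.
  have : x (■[iEx](■[iEx]■[iAll]h ∧ f))%ML.
    by apply: point_ex_and => //; apply/point_ex_all.
  by apply: point_ex_mono => w /point_and[/point_ex_all wh wf]; apply/dh'/hd.
exists z; last by apply: Tz; exists (⊥ ⇒ ⊥)%ML.
split=> g; first by move=> xg; apply: Tz; exists g => // w /point_all_T.
by move=> zg; apply: contrapT => nxg; apply: Dz zg; exists g.
Qed.

Lemma MIPC_canonical_frame : ms4_frame pt_incl all_eq.
Proof.
split.
- by move=> x f.
- by move=> x y z xy yz f /xy/yz.
- by move=> x; split=> f.
- by move=> x y [].
- by move=> x y z [xy yx] [yz zy]; split=> f; [move/xy/yz | move/zy/yx].
move=> x y z [xy yx] yz; apply: all_incl_factor => f /xy/yz //.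
Qed.

End MIPCCanonical.

(** * Filtration *)

Section Filtration.
Variables (X : Type) (Y : finType) (pi : X -> Y).

(** A predicate that factors through [pi]. *)
Definition tracked (F : X -> Prop) : Prop :=
  forall x y, pi x = pi y -> F x -> F y.

(** [r] is a filtration of [S] along [pi]: it contains the image of [S], and
    every tracked predicate that persists along [S] persists along [r]. *)
Definition filters (S : X -> X -> Prop) (r : rel Y) : Prop :=
  (forall x y, S x y -> r (pi x) (pi y)) /\
  (forall F, tracked F -> (forall x y, S x y -> F x -> F y) ->
   forall x y, r (pi x) (pi y) -> F x -> F y).

Lemma filters_converse S r : filters S r ->
  filters (fun x y => S y x) (fun a b => r b a).
Proof.
move=> [Sr rS]; split=> [x y /Sr // | F trF SF x y ryx Fx].
apply: contrapT => nFy; apply: (rS (fun z => ~ F z) _ _ _ _ ryx nFy Fx).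
  by move=> z w zw nFz Fw; apply/nFz/(trF w).
by move=> z w zw nFz /(SF _ _ zw).
Qed.

Lemma filters_equiv (S S' : X -> X -> Prop) r :
  (forall x y, S x y <-> S' x y) -> filters S r -> filters S' r.
Proof.
move=> SS' [Sr rS]; split=> [x y /SS'/Sr // | F trF S'F].
by apply: rS => // x y /SS'; apply: S'F.
Qed.

Definition comp_rel (r e : rel Y) : rel Y :=
  fun a b => [exists c, r a c && e c b].

Lemma filters_comp R E r e :
  (forall y, exists x, pi x = y) ->
  (forall x, R x x) -> (forall x, E x x) ->
  filters R r -> filters E e ->
  filters (fun x y => exists2 z, R x z & E z y) (comp_rel r e).
Proof.
move=> surj Rxx Exx [Rr rR] [Ee eE]; split=> [x y [z xz zy] | F trF SF x y].
  by apply/existsP; exists (pi z); rewrite Rr ?Ee.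
case/existsP=> c; have [z <-] := surj c; case/andP=> xz zy Fx.
apply: (eE F trF) zy _ => [u w uw|]; first by apply: SF; exists u.
by apply: (rR F trF) xz Fx => u w uw; apply: SF; exists w.
Qed.

End Filtration.

Section FiltrationExists.
Variables (X : Type) (R E : X -> X -> Prop) (RE : ms4_frame R E).
Variables (T : finType) (tau : X -> T).

(** The code of a point: its label, with the labels of its [E]-class. *)
Let code x : T * {set T} := (tau x, [set t | `[< exists2 y, E x y & tau y = t >]]).
Let Y : finType := {c : T * {set T} | `[< exists x, code x = c >]}.
Let pi x : Y := exist _ (code x) (asboolT (ex_intro _ x erefl)).
Let e : rel Y := fun a b => (val a).2 == (val b).2.
Let step : rel Y := fun a b => `[< exists x y, [/\ pi x = a, pi y = b & R x y] >].

(** A frame has a finite filtration, again a frame, that is at least as fine as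
    any given map [tau] to a finite type. *)
Lemma filtration_exists :
  exists (Z : finType) (pr : X -> Z) (r s : rel Z),
  [/\ ms4_frame (fun a b => r a b : Prop) (fun a b => s a b : Prop),
      forall z, exists x, pr x = z,
      forall x y, pr x = pr y -> tau x = tau y,
      filters pr R r
    & filters pr E s].
Proof.
case: RE => Rxx Rtr Exx Esym Etr comm.
have surj y : exists x, pi x = y.
  by case: y => c cP; have [x xc] := asboolP _ cP; exists x; apply: val_inj.
have Ee x y : E x y -> e (pi x) (pi y).
  move=> xy; apply/eqP/setP => t; rewrite !inE; apply/asboolP/asboolP.
    by case=> z xz <-; exists z => //; apply: Etr xz; apply: Esym.
  by case=> z yz <-; exists z => //; apply: Etr yz.
(* [pi] lifts [e] back to [E] *)
have back x b : e (pi x) b -> exists2 y, E x y & pi y = b.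
  have [y <-] := surj b => /eqP/= exy.
  have : tau y \in [set t | `[< exists2 y0, E x y0 & tau y0 = t >]].
    by rewrite exy inE; apply/asboolP; exists y.
  rewrite inE => /asboolP[z xz zy]; exists z => //; apply: val_inj.
  have /eqP/= exz := Ee _ _ xz.
  by rewrite /= /code zy -exz exy.
have frame_rs : ms4_frame (fun a b => connect step a b : Prop) (fun a b => e a b : Prop).
  split=> [a|a b c|a|a b|a b c|a b c].
  - exact: connect0.
  - exact: connect_trans.
  - exact: eqxx.
  - by rewrite /e eq_sym.
  - by move=> /eqP ab /eqP bc; apply/eqP; rewrite ab.
  move=> ab /connectP[s path_s ->] {c}.
  elim: s a b ab path_s => [|b' s IHs] a b ab /=; first by exists a; rewrite ?connect0.
  case/andP=> /asboolP[x [y [xb <- xy]]] path_s.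
  have [z xz za] : exists2 z, E x z & pi z = a.
    by apply: back; rewrite xb /e eq_sym.
  have [u zu uy] := comm z x y (Esym _ _ xz) xy.
  have [c uc cl] := IHs _ _ (Ee _ _ uy) path_s.
  exists c => //; apply: connect_trans uc; apply: connect1; apply/asboolP.
  by exists z, u.
exists Y, pi, (connect step), e; split=> //.
- by move=> x y /(congr1 val)[].
- split=> [x y xy | F trF RF x y /connectP[s]].
    by apply: connect1; apply/asboolP; exists x, y.
  elim: s x => [x _ /= yx | b s IHs x /=]; first by apply: trF.
  case/andP=> /asboolP[x' [b' [xx' <- xb]]] path_s last_s Fx.
  by apply: IHs path_s last_s _; apply: RF xb _; apply: trF Fx.
- split=> // F trF EF x y /back[z xz zy] Fx.
  by apply: trF zy _; apply: EF xz Fx.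
Qed.

End FiltrationExists.

(** [P] holds of all subformulas of [f], including [f]. *)
Fixpoint all_sub M (P : form M -> Prop) (f : form M) : Prop :=
  P f /\ match f with
         | Var _ | Bot => True
         | And g h | Or g h | Imp g h => all_sub P g /\ all_sub P h
         | Mod _ g => all_sub P g
         end.

Lemma all_sub_mono M (P Q : form M -> Prop) f :
  (forall g, P g -> Q g) -> all_sub P f -> all_sub Q f.
Proof.
move=> PQ; elim: f => [n||g IHg h IHh|g IHg h IHh|g IHg h IHh|m g IHg] /=;
  case=> /PQ Qf; try by [].
- by case=> /IHg Qg /IHh Qh.
- by case=> /IHg Qg /IHh Qh.
- by case=> /IHg Qg /IHh Qh.
- by move=> /IHg Qg.
Qed.

(** The truth values of the subformulas of [f] are recorded by a map to a finite
    type, here a product of copies of [bool] shaped like [f]. *)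
Lemma finite_code M X (V : X -> form M -> Prop) (f : form M) :
  exists (T : finType) (tau : X -> T),
  all_sub (fun g => forall x y, tau x = tau y -> V x g -> V y g) f.
Proof.
have dec g x y : `[< V x g >] = `[< V y g >] -> V x g -> V y g.
  by move=> xy /asboolP; rewrite xy => /asboolP.
have bin g h f' : (exists (T : finType) (tau : X -> T),
    all_sub (fun g => forall x y, tau x = tau y -> V x g -> V y g) g) ->
    (exists (T : finType) (tau : X -> T),
    all_sub (fun g => forall x y, tau x = tau y -> V x g -> V y g) h) ->
  exists (T : finType) (tau : X -> T),
    (forall x y, tau x = tau y -> V x f' -> V y f') /\
    all_sub (fun g => forall x y, tau x = tau y -> V x g -> V y g) g /\
    all_sub (fun g => forall x y, tau x = tau y -> V x g -> V y g) h.
  move=> [T1 [t1 P1]] [T2 [t2 P2]].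
  exists (bool * (T1 * T2))%type, (fun x => (`[< V x f' >], (t1 x, t2 x))).
  split; first by move=> x y [/dec].
  by split; [apply: all_sub_mono P1 | apply: all_sub_mono P2] => k Pk x y [_ t1E t2E];
    apply: Pk.
elim: f => [n||g IHg h IHh|g IHg h IHh|g IHg h IHh|m g [T [t P]]].
- by exists bool, (fun x => `[< V x (Var n) >]); split=> // x y /dec.
- by exists bool, (fun x => `[< V x Bot >]); split=> // x y /dec.
- exact (bin g h (And g h) IHg IHh).
- exact (bin g h (Or g h) IHg IHh).
- exact (bin g h (Imp g h) IHg IHh).
exists (bool * T)%type, (fun x => (`[< V x (■[m]g)%ML >], t x)).
split; first by move=> x y [/dec].
by apply: all_sub_mono P => k Pk x y [_ tE]; apply: Pk.
Qed.

(** * Algebras of a finite frame *)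

Section Box.
Variable Y : finType.
Implicit Types (r : rel Y) (A B : {set Y}).

Lemma set_leP A B : reflect {subset A <= B} (A <= B).
Proof. exact: subsetP. Qed.

(** The modal operator of a relation on a powerset. *)
Definition box r A : {set Y} := [set x | [forall y, r x y ==> (y \in A)]].

Lemma in_box r A x : reflect (forall y, r x y -> y \in A) (x \in box r A).
Proof.
rewrite inE; apply: (iffP forallP) => [H y | H y]; first exact/implyP.
by apply/implyP/H.
Qed.

Lemma in_dia r A x :
  reflect (exists2 y, r x y & y \in A) (x \in dual_op (box r) A).
Proof.
rewrite /dual_op !inE negb_forall; apply: (iffP existsP) => -[y].
  by rewrite negb_imply !inE negbK => /andP[]; exists y.
by move=> xy yA; exists y; rewrite negb_imply !inE negbK xy.
Qed.

Lemma box_interior r : reflexive r -> transitive r -> interior (box r).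
Proof.
move=> rxx rtr; split.
- move=> A B; apply/setP => x; rewrite in_setI.
  apply/in_box/andP => [xAB | [/in_box xA /in_box xB] y xy].
    by split; apply/in_box => y /xAB; rewrite in_setI => /andP[].
  by rewrite in_setI xA ?xB.
- by apply/setP => x; rewrite in_setT; apply/in_box => y _; rewrite in_setT.
- by move=> A; apply/set_leP => x /in_box; apply.
- move=> A; apply/set_leP => x /in_box xA.
  by apply/in_box => y xy; apply/in_box => z yz; apply/xA/(rtr y).
Qed.

End Box.

Section FiniteAlgebras.
Variables (Y : finType) (r e : rel Y).
Hypothesis re : ms4_frame (fun a b => r a b : Prop) (fun a b => e a b : Prop).
Local Notation q := (comp_rel r e).

Lemma comp_relP a b : reflect (exists2 c, r a c & e c b) (q a b).
Proof.
by apply: (iffP existsP) => [[c /andP[]]|[c ac cb]]; exists c => //; apply/andP.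
Qed.

Lemma comp_refl : reflexive q.
Proof.
by case: re => rxx _ exx _ _ _ a; apply/comp_relP; exists a.
Qed.

Lemma comp_trans : transitive q.
Proof.
case: re => _ rtr _ _ etr comm b a c /comp_relP[u au ub] /comp_relP[v bv vc].
have [w uw wv] := comm _ _ _ ub bv.
by apply/comp_relP; exists w; [apply: rtr uw | apply: etr vc].
Qed.

Lemma comp_r a b : r a b -> q a b.
Proof. by case: re => _ _ exx _ _ _ ab; apply/comp_relP; exists b. Qed.

Lemma comp_e a b : e a b -> q a b.
Proof. by case: re => rxx _ _ _ _ _ ab; apply/comp_relP; exists a. Qed.

Lemma MS4_complex_algebra : exists A : MS4_algebra {set Y},
  MS4_box A = box r /\ MS4_all A = box e.
Proof.
case: re => rxx rtr exx esym etr comm.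
have bi : interior (box r) by apply: box_interior => // y x z; apply: rtr.
have ai : interior (box e) by apply: box_interior => // y x z; apply: etr.
unshelve eexists; first apply: (Build_MS4_algebra bi ai).
- move=> A; apply/set_leP => x xA.
  by apply/in_box => y xy; apply/in_dia; exists x => //; apply: esym.
- move=> A; apply/set_leP => x /in_box xA.
  apply/in_box => y xy; apply/in_box => z yz.
  have [u xu uz] := comm _ _ _ xy yz.
  by have /in_box := xA _ xu; apply.
by [].
Qed.

Lemma TS4_complex_algebra : exists A : TS4_algebra {set Y},
  [/\ TS4_box A = box r, TS4_bF A = box q
    & TS4_bP A = box (fun a b => q b a)].
Proof.
case: (re) => rxx rtr exx esym etr comm.
have bi : interior (box r) by apply: box_interior => // y x z; apply: rtr.
have fi : interior (box q) := box_interior comp_refl comp_trans.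
have pi : interior (box (fun a b => q b a)).
  apply: box_interior; first exact: comp_refl.
  by move=> y x z xy yz; apply: (comp_trans yz xy).
unshelve eexists; first apply: (Build_TS4_algebra bi fi pi).
- move=> A; apply/set_leP => x xA.
  by apply/in_box => y xy; apply/in_dia; exists x.
- move=> A; apply/set_leP => x xA.
  by apply/in_box => y xy; apply/in_dia; exists x.
- move=> A; apply/set_leP => x /in_dia[y xy yA].
  by apply/in_dia; exists y => //; apply: comp_r.
- move=> A; apply/set_leP => x /in_dia[y /comp_relP[z xz zy] yA].
  apply/in_dia; exists z => //; rewrite in_setI.
  apply/andP; split; apply/in_dia; exists y => //; first exact: comp_e.
  by apply/comp_e/esym.
by [].
Qed.

End FiniteAlgebras.

Section Upsets.
Variables (Y : finType) (r : rel Y).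

Definition is_upset : pred {set Y} :=
  fun A => [forall x, forall y, r x y ==> (x \in A) ==> (y \in A)].

Lemma is_upsetP (A : {set Y}) :
  reflect (forall x y, r x y -> x \in A -> y \in A) (is_upset A).
Proof.
apply: (iffP forallP) => [H x y xy xA | H x].
  by have /forallP/(_ y) := H x; rewrite xy xA.
by apply/forallP => y; apply/implyP => xy; apply/implyP; apply: H.
Qed.

(** The lattice of upsets of [r], a sublattice of the powerset. *)
Record upset := Upset { upset_val :> {set Y}; _ : is_upset upset_val }.

HB.instance Definition _ := [isSub for upset_val].
HB.instance Definition _ := [Finite of upset by <:].

Lemma upsetI : {in is_upset &, forall A B : {set Y}, A `&` B \in is_upset}.
Proof.
move=> A B /is_upsetP uA /is_upsetP uB; apply/is_upsetP => x y xy.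
by rewrite !in_setI => /andP[/(uA _ _ xy) -> /(uB _ _ xy)].
Qed.

Lemma upsetU : {in is_upset &, forall A B : {set Y}, A `|` B \in is_upset}.
Proof.
move=> A B /is_upsetP uA /is_upsetP uB; apply/is_upsetP => x y xy.
by rewrite !in_setU => /orP[/(uA _ _ xy) -> | /(uB _ _ xy) ->]; rewrite ?orbT.
Qed.

Lemma upset0 : \bot \in is_upset.
Proof. by apply/is_upsetP => x y _; rewrite in_set0. Qed.

Lemma upsetT : \top \in is_upset.
Proof. by apply/is_upsetP => x y _ _; apply: in_setT. Qed.

HB.instance Definition _ := Order.SubChoice_isTBSubLattice.Build _ _ is_upset
  Order.SetSubsetOrder.subset_display upset upsetI upsetU upset0 upsetT.

Implicit Types A B : upset.

Lemma upset_leP A B : reflect {subset A <= B} (A <= B).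
Proof. exact: subsetP. Qed.

Lemma upset_ext A B : upset_val A =i upset_val B -> A = B.
Proof. by move=> AB; apply/val_inj/setP. Qed.

Lemma in_upsetI A B x :
  (x \in upset_val (A `&` B)) = (x \in upset_val A) && (x \in upset_val B).
Proof. exact: in_setI. Qed.

Lemma in_upsetU A B x :
  (x \in upset_val (A `|` B)) = (x \in upset_val A) || (x \in upset_val B).
Proof. exact: in_setU. Qed.

Lemma in_upset0 x : (x \in upset_val (\bot : upset)) = false.
Proof. exact: in_set0. Qed.

Lemma in_upsetT x : x \in upset_val (\top : upset).
Proof. exact: in_setT. Qed.

Lemma upset_closed A x y : r x y -> x \in upset_val A -> y \in upset_val A.
Proof. by case: A => A /= /is_upsetP uA; apply: uA. Qed.

End Upsets.

Section FiniteMonadicHeyting.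
Variables (Y : finType) (r e : rel Y).
Hypothesis re : ms4_frame (fun a b => r a b : Prop) (fun a b => e a b : Prop).
Local Notation q := (comp_rel r e).
Implicit Types A B C : upset r.

Lemma box_upset (s : rel Y) (A : {set Y}) :
  (forall x y z, r x y -> s y z -> s x z) -> is_upset r (box s A).
Proof.
move=> rs; apply/is_upsetP => x y xy /in_box xA.
by apply/in_box => z yz; apply/xA/(rs _ y).
Qed.

Lemma q_upset (A : {set Y}) : is_upset r (box q A).
Proof.
apply: box_upset => x y z /(comp_r re) xy yz; exact: (comp_trans re xy yz).
Qed.

Lemma r_upset (A : {set Y}) : is_upset r (box r A).
Proof. by apply: box_upset => x y z; apply: (frame_trans re). Qed.

Lemma e_upset A : is_upset r (dual_op (box e) (upset_val A)).
Proof.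
apply/is_upsetP => x y xy /in_dia[z xz zA].
have [u zu uy] := frame_comm re (frame_esym re xz) xy.
apply/in_dia; exists u; first exact: (frame_esym re uy).
exact: upset_closed zu zA.
Qed.

(** The monadic Heyting structure on upsets: universal quantification is along
    [R] followed by [E], since the [E]-interior of an upset need not be one. *)
Definition upset_imp A B : upset r := Upset (r_upset (~: A :|: B)).
Definition upset_all A : upset r := Upset (q_upset A).
Definition upset_ex A : upset r := Upset (e_upset A).

Lemma in_upset_imp A B x :
  reflect (forall y, r x y -> y \in upset_val A -> y \in upset_val B)
    (x \in upset_val (upset_imp A B)).
Proof.
apply: (iffP (in_box _ _ _)) => xAB y xy; have := xAB y xy; rewrite in_setU in_setC.
  by case/orP => [/negP | ].
by case: (y \in upset_val A) => //= ->.
Qed.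

Lemma monadic_heyting_upsets : exists A : monadic_heyting (upset r),
  [/\ mh_imp A = upset_imp, mh_all A = upset_all & mh_ex A = upset_ex].
Proof.
have [rxx rtr exx esym etr comm] := re.
have resid A B C : (C <= upset_imp A B) = (C `&` A <= B).
  apply/upset_leP/upset_leP => [CAB x | CAB x xC].
    by rewrite in_upsetI => /andP[/CAB/in_upset_imp xAB]; apply: xAB.
  apply/in_upset_imp => y xy yA; apply: CAB; rewrite in_upsetI yA andbT.
  exact: upset_closed xy xC.
have alli : interior upset_all.
  have [qI q1 qle qidem] := box_interior (comp_refl re) (comp_trans re).
  split.
  - by move=> A B; apply: val_inj; apply: qI.
  - by apply: val_inj; apply: q1.
  - by move=> A; apply/upset_leP/set_leP/qle.
  - by move=> A; apply/upset_leP/set_leP/qidem.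
have exc : closure upset_ex.
  split.
  - move=> A B; apply: upset_ext => x; rewrite in_upsetU.
    apply/in_dia/orP => [[y xy] | [] /in_dia[y xy yA]]; last 2 first.
    + by exists y => //; rewrite in_upsetU yA.
    + by exists y => //; rewrite in_upsetU yA orbT.
    by rewrite in_upsetU => /orP[yA | yB]; [left | right]; apply/in_dia; exists y.
  - apply: upset_ext => x; rewrite in_upset0; apply/negP => /in_dia[y _].
    by rewrite in_upset0.
  - by move=> A; apply/upset_leP => x xA; apply/in_dia; exists x.
  - move=> A; apply/upset_leP => x /in_dia[y xy /in_dia[z yz zA]].
    by apply/in_dia; exists z => //; apply: etr yz.
have ex_meet A B : upset_ex (upset_ex A `&` B) = upset_ex A `&` upset_ex B.
  apply: upset_ext => x; rewrite in_upsetI; apply/in_dia/andP.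
    case=> y xy; rewrite in_upsetI => /andP[/in_dia[z yz zA] yB].
    by split; apply/in_dia; [exists z => //; apply: etr yz | exists y].
  case=> /in_dia[z xz zA] /in_dia[y xy yB]; exists y => //.
  rewrite in_upsetI yB andbT; apply/in_dia; exists z => //.
  exact: etr (esym _ _ xy) xz.
have all_ex A : upset_all (upset_ex A) = upset_ex A.
  apply: upset_ext => x; apply/in_box/idP => [xA | xA y /comp_relP[z xz zy]].
    exact/xA/(comp_refl re).
  have /in_dia[u zu uA] := upset_closed xz xA.
  by apply/in_dia; exists u => //; apply: etr zu; apply: esym.
have ex_all A : upset_ex (upset_all A) = upset_all A.
  apply: upset_ext => x; apply/in_dia/idP => [[y xy /in_box yA] | xA]; last by exists x.
  apply/in_box => z xz; apply: yA; apply: (comp_trans re _ xz).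
  by apply: (comp_e re); apply: esym.
by exists (Build_monadic_heyting resid alli exc ex_meet all_ex ex_all).
Qed.

End FiniteMonadicHeyting.

(** * Truth lemmas and the finite model property *)

Section ClassicalTruth.
Variables (M : Type) (Ax : form M -> Prop).
Hypothesis S4Ax : forall m f, S4_axiom m f -> Ax f.
Local Notation L := (normal_logic Ax).
Implicit Types x y : point L.

(** The assignment takes the image of the truth set of each letter. *)
Lemma classical_truth (Y : finType) (pi : point L -> Y) (r : M -> rel Y)
    (op : M -> {set Y} -> {set Y}) (f : form M) x :
  (forall b : Y, exists x, pi x = b) ->
  (forall m, filters pi (@mod_rel _ Ax m) (r m)) ->
  (forall m A, op m A = box (r m) A) ->
  all_sub (fun g => tracked pi (fun x => x g)) f ->
  pi x \in eval (@bimp _ {set Y}) op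
      (fun n => [set b | `[< exists2 x : point L, pi x = b & x (Var n) >]]) f <-> x f.
Proof.
move=> surj filt opE; elim: f x => [n||g IHg h IHh|g IHg h IHh|g IHg h IHh|m g IHg] x /=.
- case=> trn _; rewrite inE; split=> [/asboolP[y yx /trn] | xn]; first exact.
  by apply/asboolP; exists x.
- by rewrite in_set0; split=> // /point_bot.
- case=> _ [/IHg{}IHg /IHh{}IHh]; rewrite in_setI point_and -IHg -IHh.
  exact: (iff_sym (rwP andP)).
- case=> _ [/IHg{}IHg /IHh{}IHh]; rewrite in_setU point_or -IHg -IHh.
  exact: (iff_sym (rwP orP)).
- case=> _ [/IHg{}IHg /IHh{}IHh]; rewrite in_setU in_setC.
  split=> [/orP[/negP ng | /IHh xh] | xgh].
  + have /point_neg xng : ~ x g by move=> /IHg.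
    by apply/point_imp => y /(_ _ xng) yng /(point_mp yng)/point_bot.
  + exact: (theory_weaken (pt_prime x) g xh).
  apply/orP; case: (pselect (x g)) => [xg | nxg].
    by right; apply/IHh/(point_mp xgh).
  by left; apply/negP => /IHg.
case=> trmg /IHg{}IHg; have [fwd bwd] := filt m.
rewrite opE; split=> [/in_box xA | xmg].
  apply/(point_box (S4Ax (m := m))) => y xy; apply/IHg/xA/fwd => //.
apply/in_box => y; have [z <-] := surj y; move=> xz; apply/IHg.
apply: (mod_refl (S4Ax (m := m))); apply: (bwd _ trmg) xz xmg => u w uw ug.
by apply: uw; apply: (point_4 (S4Ax (m := m))).
Qed.

End ClassicalTruth.

Section IntuitionisticTruth.
Implicit Types x y z : point MIPC.

Lemma intuitionistic_truth (Y : finType) (r e : rel Y) (pi : point MIPC -> Y)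
    (A : monadic_heyting (upset r)) (v : nat -> upset r) (f : form MIPC_mod) x
    (re : ms4_frame (fun a b => r a b : Prop) (fun a b => e a b : Prop)) :
  [/\ mh_imp A = upset_imp re, mh_all A = upset_all re & mh_ex A = upset_ex re] ->
  (forall b : Y, exists x, pi x = b) ->
  filters pi pt_incl r ->
  filters pi all_eq e ->
  filters pi all_incl (comp_rel r e) ->
  (forall n, tracked pi (fun x => x (Var n)) ->
    forall x, pi x \in upset_val (v n) <-> x (Var n)) ->
  all_sub (fun g => tracked pi (fun x => x g)) f ->
  pi x \in upset_val (eval (mh_imp A) (mh_op A) v f) <-> x f.
Proof.
move=> [impE allE exE] surj fR fE fQ vE.
elim: f x => [n||g IHg h IHh|g IHg h IHh|g IHg h IHh|m g IHg] x /=.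
- by case=> /vE vx _; apply: vx.
- by case=> _ _; rewrite (in_upset0 r); split=> // /point_bot.
- case=> _ [/IHg{}IHg /IHh{}IHh]; rewrite (@in_upsetI Y r) point_and -IHg -IHh.
  exact: (iff_sym (rwP andP)).
- case=> _ [/IHg{}IHg /IHh{}IHh]; rewrite (@in_upsetU Y r) point_or -IHg -IHh.
  exact: (iff_sym (rwP orP)).
- case=> trgh [/IHg{}IHg /IHh{}IHh]; have [fwd bwd] := fR.
  rewrite {1}impE; split=> [/in_upset_imp xA | xgh].
    by apply/point_imp => y /fwd xy /IHg yg; apply/IHh/(xA _ xy yg).
  apply/in_upset_imp => b; have [y <-] := surj b; move=> xy /IHg yg; apply/IHh.
  suff ygh : y (g ⇒ h)%ML by exact: point_mp ygh yg.
  by apply: (bwd _ trgh) xy xgh => u w uw; apply: uw.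
case=> trmg /IHg{}IHg; case: m trmg => trmg /=.
  have [fwd bwd] := fQ; rewrite allE; split=> [/in_box xA | xg].
    by apply/point_all => y xy; apply/IHg/xA/fwd.
  apply/in_box => b; have [y <-] := surj b; move=> xy; apply/IHg/point_all_T.
  by apply: (bwd _ trmg) xy xg => u w uw; apply: uw.
have [fwd bwd] := fE; rewrite exE; split=> [/in_dia[b] | /point_ex[y xy yg]].
  have [y <-] := surj b; move=> xy /IHg/point_ex_T.
  apply: (bwd _ trmg); first by move=> u w [uw _] /point_all_ex/uw/point_all_ex.
  exact: (frame_esym re xy).
by apply/in_dia; exists (pi y); [apply: fwd | apply/IHg].
Qed.

End IntuitionisticTruth.

Lemma TS4_has_fmp : TS4_fmp.
Proof.
move=> f nf.
have S4 m g (ax : S4_axiom m g) : TS4_axiom g := TS4_S4 ax.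
have [x0 _ nx0f] := point_separation (normal_theory TS4_axiom) (fun _ Lg => Lg) nf.
have [T [tau sub]] := finite_code (fun x : point TS4 => (x : form TS4_mod -> Prop)) f.
have [Y [pi [r [e [re surj ptau fR fE]]]]] := filtration_exists TS4_canonical_frame tau.
have [A [Abox AF AP]] := TS4_complex_algebra re.
exists _, {set Y}, A.
have fQ : filters pi (@mod_rel _ TS4_axiom tF) (comp_rel r e).
  have fC := filters_comp surj (frame_refl TS4_canonical_frame)
    (frame_erefl TS4_canonical_frame) fR fE.
  apply: filters_equiv fC => x y; split; last exact: tF_factor.
  by case=> z /tBox_tF xz [zy _]; apply: (mod_trans (S4 tF) xz zy).
pose rr m := match m with tBox => r | tF => comp_rel r e
  | tP => fun a b => comp_rel r e b a end.
exists (fun n => [set b | `[< exists2 x : point TS4, pi x = b & x (Var n) >]]).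
move=> ftop; apply/nx0f.
apply: (classical_truth (r := rr) (op := TS4_op A) S4 x0 surj _ _ _).1.
- case=> //=; apply: filters_equiv (filters_converse fQ) => x y.
  exact: iff_sym (tP_rel x y).
- by case=> B /=; rewrite ?Abox ?AF ?AP.
- by apply: all_sub_mono sub => g trg x y /ptau/trg.
- by rewrite ftop in_setT.
Qed.

Lemma MS4_has_fmp : MS4_fmp.
Proof.
move=> f nf.
have S4 m g : S4_axiom m g -> MS4_axiom g.
  by case: m => ax; [apply: MS4_Box | apply/MS4_All/S5_S4].
have [x0 _ nx0f] := point_separation (normal_theory MS4_axiom) (fun _ Lg => Lg) nf.
have [T [tau sub]] := finite_code (fun x : point MS4 => (x : form MS4_mod -> Prop)) f.
have [Y [pi [r [e [re surj ptau fR fE]]]]] := filtration_exists MS4_canonical_frame tau.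
have [A [Abox Aall]] := MS4_complex_algebra re.
exists _, {set Y}, A.
pose rr m := match m with mBox => r | mAll => e end.
exists (fun n => [set b | `[< exists2 x : point MS4, pi x = b & x (Var n) >]]).
move=> ftop; apply/nx0f.
apply: (classical_truth (r := rr) (op := MS4_op A) S4 x0 surj _ _ _).1.
- by case.
- by case=> B /=; rewrite ?Abox ?Aall.
- by apply: all_sub_mono sub => g trg x y /ptau/trg.
- by rewrite ftop in_setT.
Qed.

Lemma MIPC_has_fmp : MIPC_fmp.
Proof.
move=> f nf.
have [x0 _ nx0f] := point_separation MIPC_theory (fun _ Lg => Lg) nf.
have [T [tau sub]] := finite_code (fun x : point MIPC => (x : form MIPC_mod -> Prop)) f.
have [Y [pi [r [e [re surj ptau fR fE]]]]] := filtration_exists MIPC_canonical_frame tau.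
have [A [Aimp Aall Aex]] := monadic_heyting_upsets re.
exists _, (upset r), A.
have fQ : filters pi all_incl (comp_rel r e).
  have fC := filters_comp surj (frame_refl MIPC_canonical_frame)
    (frame_erefl MIPC_canonical_frame) fR fE.
  apply: filters_equiv fC => x y; split; last exact: all_incl_factor.
  by case=> z xz [zy _] g /xz/zy.
(* a letter outside [f] need not be tracked, and the image of its truth set need
   not be an upset; taking the interior repairs this and does not affect the
   letters of [f] *)
pose v n : upset r :=
  Upset (r_upset re [set b | `[< exists2 x : point MIPC, pi x = b & x (Var n) >]]).
exists v => ftop; apply/nx0f.
apply: (intuitionistic_truth (A := A) (v := v) (re := re) x0 _ surj fR fE fQ _ _).1.
- by split.
- move=> n trn x; split=> [/in_box/(_ _ (frame_refl re _)) | xn].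
    by rewrite inE => /asboolP[y yx /trn]; apply.
  apply/in_box => b; have [y <-] := surj b; move=> xy; rewrite inE; apply/asboolP.
  exists y => //; apply: (fR.2 _ trn) xy xn => u w uw; exact: uw.
- by apply: all_sub_mono sub => g trg x y /ptau/trg.
- by rewrite ftop in_upsetT.
Qed.

Theorem theorem5p4 : TS4_fmp /\ MS4_fmp /\ MIPC_fmp.
Proof.
by split; [exact: TS4_has_fmp | split; [exact: MS4_has_fmp | exact: MIPC_has_fmp]].
Qed.
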